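(* Let $G$ be a (possibly infinite) chordal graph that contains no strict comb of cliques. Then $G$ has a tree-decomposition into maximal cliques, i.e. a tree-decomposition $(T,(V_t)_{t\in V(T)})$ of $G$ such that every part $V_t$ is the vertex set of a maximal clique of $G$.
   Context: A graph is chordal if it has no induced cycle of length at least four. A strict comb of cliques in a graph $G$ consists of a countably infinite clique $\{v_i : i\in\mathbb N\}$ of $G$ together with, for each $i>1$, a vertex of $G$ that is adjacent to all of $v_1,\dots,v_{i-1}$ but to none of $v_i,v_{i+1},v_{i+2},\dots$. A tree-decomposition is in the usual (Diestel) sense: a tree $T$ and parts $V_t\subseteq V(G)$ covering all vertices and edges, such that for each vertex the nodes whose parts contain it form a subtree. *)

(* Defs.v *)
From Stdlib Require Import Relation_Operators.
From mathcomp Require Import all_boot.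
From mathcomp Require Import classical_sets.
Set Implicit Arguments.
Unset Strict Implicit.
Unset Printing Implicit Defensive.
Local Open Scope classical_set_scope.

(* Simple graphs on an arbitrary, possibly infinite, vertex type. *)
Record sgraph := SGraph {
  vertex :> Type;
  adj : vertex -> vertex -> Prop;
  adj_sym : forall x y, adj x y -> adj y x;
  adj_irrefl : forall x, ~ adj x x }.

Arguments adj {s}.

Definition induced (G : sgraph) (S : set G) : sgraph :=
  @SGraph (set_type S) (fun x y => adj (val x) (val y))
    (fun x y => @adj_sym G (val x) (val y)) (fun x => @adj_irrefl G (val x)).

(* [ordS] is the cyclic successor on ['I_n]. *)
Definition is_cycle (G : sgraph) (n : nat) (c : 'I_n -> G) : Prop :=
  [/\ (3 <= n)%N, injective c & forall i, adj (c i) (c (ordS i))].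

Definition is_induced_cycle (G : sgraph) (n : nat) (c : 'I_n -> G) : Prop :=
  is_cycle c /\ forall i j, adj (c i) (c j) -> j = ordS i \/ i = ordS j.

Definition chordal (G : sgraph) : Prop :=
  forall n (c : 'I_n -> G), (4 <= n)%N -> ~ is_induced_cycle c.

Definition is_clique (G : sgraph) (K : set G) : Prop :=
  forall x y, K x -> K y -> x <> y -> adj x y.

Definition is_maximal_clique (G : sgraph) (K : set G) : Prop :=
  is_clique K /\ forall L : set G, is_clique L -> K `<=` L -> L = K.

(* The clique is indexed from 0, so the condition [i > 1] for indices starting
   at 1 becomes [i > 0]. *)
Definition is_strict_comb (G : sgraph) (v : nat -> G) : Prop :=
  [/\ injective v, is_clique (range v) &
      forall i, (0 < i)%N -> exists u : G,
        (forall j, (j < i)%N -> adj u (v j)) /\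
        (forall j, (i <= j)%N -> ~ adj u (v j))].

Definition has_strict_comb (G : sgraph) : Prop :=
  exists v : nat -> G, is_strict_comb v.

Definition connected_graph (G : sgraph) : Prop :=
  inhabited G /\ forall x y : G, clos_refl_trans G adj x y.

Definition acyclic (G : sgraph) : Prop :=
  forall n (c : 'I_n -> G), ~ is_cycle c.

Definition is_tree (G : sgraph) : Prop := connected_graph G /\ acyclic G.

Definition is_tree_decomposition (G T : sgraph) (V : T -> set G) : Prop :=
  [/\ is_tree T,
      forall x : G, exists t, V t x,
      forall x y : G, adj x y -> exists t, V t x /\ V t y &
      forall x : G, is_tree (induced [set t | V t x])].

(* Main.v *)
Require Import Defs.
From mathcomp Require Import all_boot.
From mathcomp Require Import classical_sets.
From Stdlib Require Import Relation_Operators Operators_Properties.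
From mathcomp Require Import boolp zify.
Set Implicit Arguments.
Unset Strict Implicit.
Unset Printing Implicit Defensive.
Local Open Scope classical_set_scope.

(** The tree is built level by level. Start with the piece [C = V(G)]; below a
    piece [C] with boundary [N(C)] choose a maximal clique [K] containing [N(C)]
    and contained in [C] together with [N(C)], and make the components of [C - K]
    the children of [C]. If [K] is a clique and the traces [N(u) & K] have no
    infinite strictly ascending chain -- such a chain is the same thing as a
    strict comb -- then traces can be maximised. For a connected [C] this and
    chordality give a vertex of [C] adjacent to all of [N(C)], so that [K] can be
    chosen to meet [C]. The same principle shows that a vertex cannot survive
    infinitely many levels, so that the chosen cliques cover the graph. *)

(** * Trees from a level function *)

(** Descending along [h] always ends in [r], whence connectedness. The level of [r] is arbitrary, so
    this serves for the whole tree and for its subtrees alike. *)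
Lemma graded_is_tree (T : sgraph) (h : T -> nat) (r : T) :
    (forall x y, adj x y -> h y = (h x).+1 \/ h x = (h y).+1) ->
    (forall x y z, adj x z -> adj y z ->
       h z = (h x).+1 -> h z = (h y).+1 -> x = y) ->
    (forall x, x = r \/ exists2 y, adj x y & h x = (h y).+1) ->
  is_tree T.
Proof.
move=> hadj hparent hroot; split.
  split; first by constructor; exact: r.
  have to_root x : clos_refl_trans T adj x r /\ clos_refl_trans T adj r x.
    move: {2}(h x) (leqnn (h x)) => n; elim: n x => [|n IH] x lexn;
      case: (hroot x) => [->|[y xy hxy]]; try by split; apply: rt_refl.
      by move: lexn; rewrite hxy.
    have [|yr ry] := IH y; first by rewrite -ltnS -hxy.
    split; first exact: rt_trans (rt_step _ _ _ _ xy) yr.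
    exact: rt_trans ry (rt_step _ _ _ _ (adj_sym xy)).
  by move=> x y; apply: rt_trans (to_root x).1 (to_root y).2.
move=> n c [n3 cinj cadj].
have i0 : 'I_n by apply: (@Ordinal n 0); lia.
(* A vertex of maximal height on a cycle would have two lower neighbours. *)
case: (@arg_maxnP _ i0 xpredT (h \o c)) => // i _ imax.
have up := cadj i; have down := adj_sym (cadj (ord_pred i)).
rewrite ord_predK in down.
have e : c (ordS i) = c (ord_pred i).
  apply: (hparent _ _ (c i)); [exact: adj_sym| exact: adj_sym| |].
    have := imax (ordS i) isT; rewrite /= /geq /=.
    by case: (hadj _ _ up) => //; lia.
  have := imax (ord_pred i) isT; rewrite /= /geq /=.
  by case: (hadj _ _ down) => //; lia.
have /(congr1 (fun j => val (ordS j))) := cinj _ _ e.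
rewrite ord_predK /=.
have [lt2|ge2] := ltnP i.+1 n.
  rewrite (modn_small lt2).
  have [lt3|ge3] := ltnP i.+2 n; first by rewrite modn_small //; lia.
  have -> : i.+2 = n by lia.
  by rewrite modnn; lia.
have -> : i.+1 = n by have := ltn_ord i; lia.
by rewrite modnn modn_small; lia.
Qed.

(** * Holes in chordal graphs *)

Section Chordal.
Variables (G : sgraph) (hG : chordal G).

(** Chordality with cycles indexed by [nat] and only pairs [i < j] compared, so that adjacency
    becomes arithmetic; the pair [0], [n.-1] is the closing edge. *)
Lemma chordal_no_hole n (f : nat -> G) : (4 <= n)%N ->
    (forall i j, (i < j < n)%N -> f i <> f j) ->
    (forall i j, (i < j < n)%N ->
       adj (f i) (f j) <-> j = i.+1 \/ i = 0 /\ j = n.-1) ->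
  False.
Proof.
move=> n4 finj fadj; apply: (hG (c := fun i : 'I_n => f i) n4); split; first split.
- by lia.
- move=> i j /= e; apply/val_inj => /=; have := ltn_ord i; have := ltn_ord j.
  case: (ltngtP i j) => // ij jn jn'.
    by case: (finj i j) => //; lia.
  by case: (finj j i) => //; lia.
- move=> i /=; have [lt|ge] := ltnP i.+1 n.
    by rewrite modn_small //; apply/fadj; [lia|left].
  have -> : i.+1 = n by have := ltn_ord i; lia.
  rewrite modnn; apply/adj_sym/fadj; [have := ltn_ord i; lia|right].
  by have := ltn_ord i; lia.
- have hlt (i j : 'I_n) : (i < j)%N -> adj (f i) (f j) -> j = ordS i \/ i = ordS j.
    move=> ij; have jn := ltn_ord j => /fadj [|ji|[i0 jn1]]; first by lia.
      by left; apply/val_inj; rewrite /= modn_small // -ji.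
    right; apply/val_inj => /=; rewrite jn1 prednK ?modnn //; lia.
  move=> i j a; case: (ltngtP i j) => ij.
  - exact: hlt.
  - by case: (hlt j i ij (adj_sym a)); [right|left].
  - by move: a; rewrite ij => /adj_irrefl.
Qed.

Lemma chordal_square (a b c d : G) : adj a b -> adj b c -> adj c d -> adj d a ->
  a <> c -> b <> d -> adj a c \/ adj b d.
Proof.
move=> ab bc cd da ac bd; apply: contrapT => /not_orP [nac nbd].
have neq x y : adj x y -> x <> y by move=> + e; rewrite e => /adj_irrefl.
pose f i := match i with 0 => a | 1 => b | 2 => c | _ => d end.
apply: (@chordal_no_hole 4 f) => // i j.
- move: i j => [|[|[|[|i]]]] [|[|[|[|j]]]] //= ij;
    first [exact: neq | by move/esym; apply: neq | by lia].
- move: i j => [|[|[|[|i]]]] [|[|[|[|j]]]] //= ij; try lia; split=> H;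
    first [by left | by right | done | exact: adj_sym | lia].
Qed.

(** The hole is [a], [p 0], ..., [p m], [y]; its length [m.+3] is at least four because [0 < m]. *)
Lemma chordal_no_hole_path (a y : G) m (p : nat -> G) : (0 < m)%N -> adj y a ->
    (forall i, (i <= m)%N -> p i <> a /\ p i <> y) ->
    (forall i j, (i < j <= m)%N -> p i <> p j) ->
    (forall i j, (i < j <= m)%N -> adj (p i) (p j) <-> j = i.+1) ->
    (forall i, (i <= m)%N -> adj a (p i) <-> i = 0) ->
    (forall i, (i <= m)%N -> adj y (p i) <-> i = m) ->
  False.
Proof.
move=> m0 ya pout pinj padj pa py.
pose f i := if i == 0 then a else if (i <= m.+1)%N then p i.-1 else y.
have f0 : f 0 = a by [].
have fp i : (0 < i <= m.+1)%N -> f i = p i.-1.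
  by move=> im; rewrite /f; case: eqP => [|_]; [lia|have -> : (i <= m.+1)%N by lia].
have fy : f m.+2 = y by rewrite /f ltnn.
apply: (@chordal_no_hole m.+3 f) => // i j ij.
- have [->|i0] := posnP i.
    rewrite f0; have [jm|jm] := leqP j m.+1.
      by rewrite fp; [have := pout j.-1; move=> []; [lia|move=> + _ => /nesym]|lia].
    have -> : j = m.+2 by lia.
    by rewrite fy => e; move: ya; rewrite e => /adj_irrefl.
  rewrite fp; last by lia.
  have [jm|jm] := leqP j m.+1.
    by rewrite fp; [apply: pinj|]; lia.
  have -> : j = m.+2 by lia.
  by rewrite fy; have := pout i.-1; move=> []; [lia|].
- have [->|i0] := posnP i.
    rewrite f0; have [jm|jm] := leqP j m.+1.
      by rewrite fp; last lia; rewrite pa; lia.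
    have -> : j = m.+2 by lia.
    by rewrite fy; split=> [_|_]; [right|exact: adj_sym].
  rewrite fp; last by lia.
  have [jm|jm] := leqP j m.+1.
    by rewrite fp; last lia; rewrite padj; lia.
  have -> : j = m.+2 by lia.
  rewrite fy; split=> [/adj_sym/py H|H].
    by left; have := H; lia.
  by apply/adj_sym/py; lia.
Qed.

End Chordal.

(** * Maximal traces and maximal cliques *)

(** If no trace on [K] is maximal, some [u i] in [P] have strictly growing traces. Picking [v i] in
    [K] from the gain between [u i] and [u i.+1] makes [u i] adjacent to [v j] exactly for [j < i]:
    a strict comb. *)
Lemma exists_max_trace (G : sgraph) (K P : set G) :
    ~ has_strict_comb G -> is_clique K -> P !=set0 ->
  exists2 u, P u & forall w, P w ->
    (forall k, K k -> adj u k -> adj w k) ->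
    (forall k, K k -> adj w k -> adj u k).
Proof.
move=> hcomb hK [u0 Pu0]; apply: contrapT => /forall2NP nomax; apply: hcomb.
have step (u : {x | P x}) : exists w : {x | P x},
    (forall k, K k -> adj (sval u) k -> adj (sval w) k) /\
    exists k, [/\ K k, adj (sval w) k & ~ adj (sval u) k].
  case: u => u Pu /=; case: (nomax u) => // /existsNP [w /not_implyP [Pw]].
  move=> /not_implyP [sub] /existsNP [k] /not_implyP [Kk] /not_implyP [wk uk].
  by exists (exist _ w Pw); split=> //; exists k.
have [next nextP] := choice step.
pose u i := sval (iter i next (exist _ u0 Pu0)).
have umono i j k : (i <= j)%N -> K k -> adj (u i) k -> adj (u j) k.
  move=> /subnK <- Kk uk; elim: (j - i) => [//|n IH].
  by rewrite addSn; apply: (nextP _).1.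
have /choice [v vP] i : exists k, [/\ K k, adj (u i.+1) k & ~ adj (u i) k].
  exact: (nextP (iter i next _)).2.
have uv i j : (j < i)%N -> adj (u i) (v j).
  by move=> ji; case: (vP j) => Kv uv _; apply: umono ji Kv uv.
have nuv i j : (i <= j)%N -> ~ adj (u i) (v j).
  by move=> ij a; case: (vP j) => Kv _; apply; apply: umono ij Kv a.
exists v; split.
- move=> i j e; case: (ltngtP i j) => // ij.
    by case: (nuv j j) => //; rewrite -e; apply: uv.
  by case: (nuv i i) => //; rewrite e; apply: uv.
- by move=> _ _ [i _ <-] [j _ <-]; apply: hK; case: (vP i) (vP j) => ? ? ? [].
- by move=> i _; exists (u i); split=> j; [apply: uv|apply: nuv].
Qed.

(** Zorn's lemma is applied to the sets whose union with [L] is a clique, so that the empty chain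
    too has its union in the family. *)
Lemma clique_extends (G : sgraph) (L : set G) : is_clique L ->
  exists2 K, is_maximal_clique K & L `<=` K.
Proof.
move=> hL.
have [F FP tF|A [hA maxA]] := @Zorn_bigcup G [set A | is_clique (A `|` L)].
  move=> x y [[X FX Xx]|Lx] [[Y FY Yy]|Ly].
  - case: (tF X Y FX FY) => XY.
      by apply: (FP Y FY); left => //; apply: XY.
    by apply: (FP X FX); left => //; apply: XY.
  - by apply: (FP X FX); [left|right].
  - by apply: (FP Y FY); [right|left].
  - exact: hL.
exists (A `|` L); last by move=> x; right.
split=> // M hM AM; apply: contrapT => neq.
have LM : L `<=` M by move=> x Lx; apply: AM; right.
apply: (maxA M); last by rewrite /= setUidl.
split; first by move=> x Ax; apply: AM; left.
by move=> MA; apply: neq; apply/seteqP; split=> // x /MA; left.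
Qed.

Lemma maximal_clique_mem (G : sgraph) (K : set G) (x : G) :
  is_maximal_clique K -> (forall k, K k -> x <> k -> adj x k) -> K x.
Proof.
move=> [hK maxK] hx; rewrite -(maxK (x |` K)); first by left.
  move=> y z [->|Ky] [->|Kz] //; [exact: hx| |exact: hK].
  by move=> /nesym yx; apply/adj_sym/hx.
by move=> y; right.
Qed.

(** * Components, boundaries and walks *)

Section Components.
Variable G : sgraph.
Implicit Types (A C D : set G) (x y z : G).

(** Reflexive at every vertex, even outside [A]; hence the separate condition [A y] in
    [component]. *)
Definition linked A : G -> G -> Prop :=
  clos_refl_trans G (fun u v => [/\ A u, A v & adj u v]).

Definition component A x : set G := [set y | A y /\ linked A x y].

Definition connected_in C := forall x y, C x -> C y -> linked C x y.

Definition boundary C : set G := [set y | ~ C y /\ exists2 z, C z & adj z y].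

Lemma linked_sym A x y : linked A x y -> linked A y x.
Proof.
elim=> {x y} [x y [Ax Ay xy]|x|x y z _ xy _ yz].
- by apply: rt_step; split=> //; apply: adj_sym.
- exact: rt_refl.
- exact: rt_trans yz xy.
Qed.

Lemma linked_cross A D x y : linked A x y -> D x -> ~ D y ->
  exists u v, [/\ D u, ~ D v, A v & adj u v].
Proof.
elim=> {x y} [x y [Ax Ay xy]|//|x y z _ xy _ yz] Dx Dy; first by exists x, y.
by have [Dz|Dz] := pselect (D y); [exact: yz|exact: xy].
Qed.

Lemma component_refl A x : A x -> component A x x.
Proof. by move=> Ax; split=> //; apply: rt_refl. Qed.

Lemma component_adj A x y z : component A x y -> A z -> adj y z ->
  component A x z.
Proof.
move=> [Ay xy] Az yz; split=> //.
by apply: rt_trans xy _; apply: rt_step; split.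
Qed.

Lemma component_eq A x y : component A x y -> component A y = component A x.
Proof.
move=> [Ay xy]; apply/seteqP; split=> z [Az l]; split=> //.
  exact: rt_trans xy l.
by apply: rt_trans l; apply: linked_sym.
Qed.

Lemma component_connected A x : A x -> connected_in (component A x).
Proof.
move=> Ax.
have from_x y : component A x y -> linked (component A x) x y.
  move=> [_ /(@clos_rt_rtn1 _ _ _ _)]; elim=> [|{}y z [Ay Az yz] xy IH].
    exact: rt_refl.
  have Cy : component A x y by split=> //; apply: clos_rtn1_rt.
  by apply: rt_trans IH _; apply: rt_step; split=> //; apply: component_adj Cy _ _.
by move=> y z /from_x/linked_sym xy /from_x; apply: rt_trans.
Qed.

Lemma boundary_component A x y : boundary (component A x) y -> ~ A y.
Proof. by move=> [nCy [z Cz zy]] Ay; apply: nCy; apply: component_adj Cz Ay zy. Qed.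

(** Counting the steps of [linked] makes shortest walks available by minimising [n]. *)
Fixpoint walk C x n : set G :=
  if n is n'.+1 then [set y | C y /\ exists2 u, walk C x n' u & adj u y]
  else [set x].

Lemma linked_walk C x y : linked C x y -> exists n, walk C x n y.
Proof.
move=> /(@clos_rt_rtn1 _ _ _ _); elim=> [|{}y z [Cy Cz yz] _ [n w]].
  by exists 0.
by exists n.+1; split=> //; exists y.
Qed.

Lemma walk_path C x n y : walk C x n y ->
  exists p : nat -> G, [/\ p n = y, forall i, (i <= n)%N -> walk C x i (p i) &
    forall i, (i < n)%N -> adj (p i) (p i.+1)].
Proof.
elim: n y => [|n IH] y /= => [->|[Cy [u /IH [p [pn wp ap]] uy]]].
  by exists (fun=> x); split=> // -[].
exists (fun i => if (i <= n)%N then p i else y); split.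
- by rewrite ltnn.
- move=> i; rewrite leq_eqVlt ltnS => /orP [/eqP ->|le]; last by rewrite le; apply: wp.
  by rewrite ltnn; split=> //; exists u => //; rewrite -pn; apply: wp.
- move=> i lei; have [->|lt] : i = n \/ (i < n)%N by lia.
    by rewrite leqnn ltnn pn.
  by rewrite lt (ltnW lt); apply: ap.
Qed.

Lemma walk_in C x n y : C x -> walk C x n y -> C y.
Proof. by case: n => [Cx ->|n Cx []]. Qed.

End Components.

(** * Cliques and pieces in chordal graphs without strict combs *)

Section NoComb.
Variables (G : sgraph) (hG : chordal G) (hcomb : ~ has_strict_comb G).
Implicit Types (C K S : set G) (x y : G).

(** Let [c] have maximal trace on the boundary. If [c] misses a boundary vertex, take a shortest
    walk in [C] from [c] to some [p m] with a boundary neighbour [y] missed by [c]. By maximality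
    [p m] misses some boundary neighbour [a] of [c]. With [p i] the last vertex of the walk adjacent
    to [a], the cycle [a], [p i], ..., [p m], [y] is a hole. *)
Lemma boundary_dominated C : C !=set0 -> connected_in C ->
  is_clique (boundary C) ->
  exists2 c, C c & forall k, boundary C k -> adj c k.
Proof.
move=> C0 Ccon hK; have [c Cc maxc] := exists_max_trace hcomb hK C0.
exists c => // k0 Kk0; apply: contrapT => nck0.
pose target w := exists y, [/\ boundary C y, ~ adj c y & adj w y].
have ex_len : exists n, `[< exists2 w, walk C c n w & target w >].
  have [_ [w Cw wk0]] := Kk0; have [n wn] := linked_walk (Ccon _ _ Cc Cw).
  by exists n; apply/asboolP; exists w => //; exists k0.
case: (ex_minnP ex_len) => m /asboolP [w wm [y [Ky ncy wy]]] mmin.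
have [p [pm pw pa]] := walk_path wm; rewrite -pm in wy => {w wm pm ex_len}.
have pC i : (i <= m)%N -> C (p i) by move=> /pw; apply: walk_in.
(* A shortcut to [p i], continued along the walk, would reach a target in fewer than [m] steps. *)
have not_target i k : (i <= m)%N -> walk C c k (p i) -> (i <= k)%N.
  move=> im wk; have ext j : (i + j <= m)%N -> walk C c (k + j) (p (i + j)).
    elim: j => [|j IH]; first by rewrite !addn0.
    rewrite !addnS => lt; split; first exact: pC.
    by exists (p (i + j)); [apply/IH/ltnW|apply: pa].
  have := mmin (k + (m - i)); move=> h; suff : (m <= k + (m - i))%N by lia.
  apply: h; apply/asboolP; exists (p m); last by exists y.
  by have := ext (m - i); rewrite subnKC //; apply.
(* Again by minimality of [m]; in particular [y] is adjacent to no [p i] with [i < m]. *)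
have small i k : (i < m)%N -> boundary C k -> adj (p i) k -> adj c k.
  move=> im Kk ik; apply: contrapT => nck.
  have := mmin i; suff : `[< exists2 w, walk C c i w & target w >].
    by move=> + H => /H; lia.
  by apply/asboolP; exists (p i); [apply/pw/ltnW|exists k].
have p0 : p 0 = c by apply: (pw 0).
have m0 : (0 < m)%N by case: m wy {mmin pw pa pC not_target small} => //; rewrite p0.
(* Otherwise the trace of [p m] contains that of [c], and maximality makes [c] adjacent to [y]. *)
have [a [Ka ca npa]] : exists a, [/\ boundary C a, adj c a & ~ adj (p m) a].
  apply: contrapT => noa; apply: ncy; apply: (maxc (p m)) => //; first exact: pC.
  by move=> k Kk ck; apply: contrapT => nk; apply: noa; exists k.
have ex_a : exists i, `[< (i <= m)%N /\ adj (p i) a >].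
  by exists 0; apply/asboolP; rewrite p0.
have ub_a i : `[< (i <= m)%N /\ adj (p i) a >] -> (i <= m)%N by move=> /asboolP [].
case: (ex_maxnP ex_a ub_a) => i /asboolP [im ia] imax.
have {}im : (i < m)%N.
  by rewrite ltn_neqAle im andbT; apply/eqP => e; apply: npa; rewrite -e.
apply: (@chordal_no_hole_path G hG a y (m - i) (fun j => p (i + j))).
- by lia.
- by apply: hK => // e; apply: ncy; rewrite e.
- move=> j jm; have Cp : C (p (i + j)) by apply: pC; lia.
  by split=> e; [case: Ka|case: Ky]; rewrite -e.
- move=> j k jk e; suff : (i + k <= i + j)%N by lia.
  by apply: not_target; [lia|rewrite -e; apply: pw; lia].
- move=> j k jk; split=> [jka|->]; last by rewrite addnS; apply: pa; lia.
  suff : (i + k <= (i + j).+1)%N by lia.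
  apply: not_target; first by lia.
  by split; [apply: pC; lia|exists (p (i + j)) => //; apply: pw; lia].
- move=> j jm; split=> [aj|->]; last by rewrite addn0; apply: adj_sym.
  suff : (i + j <= i)%N by lia.
  by apply: imax; apply/asboolP; split; [lia|apply: adj_sym].
- move=> j jm; split=> [yj|->]; last by rewrite subnKC ?(ltnW im) //; apply: adj_sym.
  apply: contrapT => jm'; apply: ncy; apply: (small (i + j)) => //; first by lia.
  exact: adj_sym.
Qed.

(** Take [s] in [S] outside [K] with maximal trace on [K], and [u] in [K] not adjacent to [s]. If
    [u] had a neighbour [t] in [S] outside [K], maximality would give [w] in [K] adjacent to [s] but
    not to [t], and [s], [t], [u], [w] would be an induced square. *)
Lemma maximal_clique_separates K S : is_maximal_clique K -> is_clique S ->
  ~ S `<=` K ->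
  exists u, [/\ K u, ~ S u & forall s, S s -> adj u s -> K s].
Proof.
move=> hK hS nSK.
have SK0 : (S `\` K) !=set0.
  apply: contrapT => no; apply: nSK => s Ss; apply: contrapT => nKs.
  by apply: no; exists s.
have [s [Ss nKs] smax] := exists_max_trace hcomb hK.1 SK0.
have [u [Ku su nsu]] : exists u, [/\ K u, s <> u & ~ adj s u].
  apply: contrapT => no; apply: nKs; apply: maximal_clique_mem hK _ => k Kk sk.
  by apply: contrapT => nsk; apply: no; exists k.
have nSu : ~ S u by move=> Su; apply: nsu; apply: hS.
exists u; split=> // t St ut; apply: contrapT => nKt.
have [w [Kw sw ntw]] : exists w, [/\ K w, adj s w & ~ adj t w].
  apply: contrapT => no; apply: nsu; apply: (smax t) => //; last exact: adj_sym.
  by move=> k Kk sk; apply: contrapT => ntk; apply: no; exists k.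
have st : adj s t by apply: hS => // e; apply: nsu; rewrite e; apply: adj_sym.
have uw : adj u w by apply: hK.1 => // e; apply: nsu; rewrite e.
have tw : t <> w by move=> e; apply: nKt; rewrite e.
by case: (chordal_square hG st (adj_sym ut) uw (adj_sym sw) su tw).
Qed.

(* The boundary [S] of the component [D] of [x] in the intersection of the
   [C n] is a clique exhausted by the increasing sets [S `&` K n], none of which
   is all of [S]; each of them is a trace on [S], contradicting maximality. *)
Lemma no_infinite_descent (C K : nat -> set G) x :
    (forall n, C n x) -> (forall n, C n.+1 `<=` C n `\` K n) ->
    (forall n, connected_in (C n.+1)) -> (forall n, (C n `&` K n) !=set0) ->
    (forall n, is_maximal_clique (K n)) ->
    (forall n, boundary (C n) `<=` K n) ->
  False.
Proof.
move=> Cx Cdecr Ccon CK Kmax CbK.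
have CnK n y : C n.+1 y -> ~ K n y by move=> /Cdecr [].
pose A := \bigcap_n C n; pose D := component A x; pose S := boundary D.
have DC n z : D z -> C n z by move=> [Az _]; apply: Az.
have Dx : D x by apply: component_refl => n _; apply: Cx.
(* Lying in [K n] keeps [y] out of [C n.+1], but [y] has a neighbour in [D], so it is in the
   boundary of [C n.+1]. *)
have Kstep n y : S y -> K n y -> K n.+1 y.
  move=> [_ [z Dz zy]] Ky; apply: CbK; split; last by exists z => //; apply: DC.
  by move=> /CnK.
have Kmono n m y : (n <= m)%N -> S y -> K n y -> K m y.
  move=> /subnK <- Sy Ky; elim: (m - n) => [//|k IH].
  by rewrite addSn; apply: Kstep.
have Kev y : S y -> exists n, K n y.
  move=> Sy; have [_ [z Dz zy]] := Sy.
  have /existsNP [n nCy] : ~ forall n, C n y.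
    by move=> all; apply: (boundary_component Sy) => n _; apply: all.
  by exists n; apply: CbK; split=> //; exists z => //; apply: DC.
have Scl : is_clique S.
  move=> y z Sy Sz; have [n Kn] := Kev y Sy; have [m Km] := Kev z Sz.
  by apply: (Kmax (maxn n m)).1; [apply: Kmono Sy Kn|apply: Kmono Sz Km]; lia.
(* A path in [C n.+1] from [x] to a vertex of [K n.+1] must leave [D]; the vertex where it does is
   in [S] and in [C n.+1], hence not in [K n]. *)
have nSK n : exists2 y, S y & ~ K n y.
  have [k [Ck Kk]] := CK n.+1.
  have nDk : ~ D k by move=> /(DC n.+2)/CnK.
  have [u [v [Du nDv Cv uv]]] := linked_cross (Ccon n _ _ (Cx n.+1) Ck) Dx nDk.
  by exists v; [split=> //; exists u|apply: CnK].
have /choice [u uP] n : exists u, [/\ K n u, ~ S u & forall s, S s -> adj u s -> K n s].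
  apply: maximal_clique_separates => // sub.
  by have [y Sy] := nSK n; apply; apply: sub.
have Ku n s : S s -> K n s -> adj (u n) s.
  move=> Ss Ks; case: (uP n) => Kun nSu _; apply: (Kmax n).1 => // e.
  by apply: nSu; rewrite e.
have u0 : range u !=set0 by exists (u 0); apply: imageT.
have [_ [n _ <-] nmax] := exists_max_trace hcomb Scl u0.
have [y Sy nKy] := nSK n; have [m Km] := Kev y Sy.
have nm : (n <= m)%N.
  by rewrite leqNgt; apply/negP => /ltnW mn; apply: nKy; apply: Kmono mn Sy Km.
have [_ _ un] := uP n.
apply: nKy; apply: (un y Sy); apply: (nmax (u m)) => //.
- move=> k Sk /(un k Sk) Kk; apply: Ku => //; exact: Kmono nm Sk Kk.
- exact: Ku.
Qed.

Definition is_piece C :=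
  C = setT \/ [/\ C !=set0, connected_in C & is_clique (boundary C)].

(** The third clause puts a bag vertex outside [C] into the boundary, hence into the parent bag; the
    last one rules out endless descent. *)
Definition is_bag C K :=
  [/\ is_maximal_clique K, boundary C `<=` K, K `<=` C `|` boundary C &
      C !=set0 -> (C `&` K) !=set0].

(** If [c] in [C] is adjacent to the whole boundary, extend the boundary with [c] to a maximal
    clique: every clique through [c] stays within [C] and its boundary. *)
Lemma piece_has_bag C : is_piece C -> exists K, is_bag C K.
Proof.
move=> [->|[C0 Ccon hK]].
  (* At the root the boundary is empty, so any vertex can start the clique. *)
  have [L [hL L0]] : exists L : set G, is_clique L /\ ([set: G] !=set0 -> L !=set0).
    have [[x _]|no] := pselect ([set: G] !=set0).
      by exists [set x]; split=> [_ _ -> -> //|_]; exists x.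
    by exists set0; split=> // _ _ [].
  have [K hKm LK] := clique_extends hL; exists K; split=> //.
  - by move=> y [nT]; case: nT.
  - by move=> y _; left.
  - by move=> /L0 [y /LK Ky]; exists y.
have [c Cc ck] := boundary_dominated C0 Ccon hK.
have hL : is_clique (c |` boundary C).
  move=> x y [->|Kx] [->|Ky] //; [by move=> _; apply: ck| |exact: hK].
  by move=> _; apply/adj_sym/ck.
have [K hKm LK] := clique_extends hL; have Kc : K c by apply: LK; left.
exists K; split=> //; first by move=> y Ky; apply: LK; right.
- move=> y Ky; have [Cy|nCy] := pselect (C y); [by left|right; split=> //].
  by exists c => //; apply: hKm.1 => // e; apply: nCy; rewrite -e.
- by exists c.
Qed.

End NoComb.

(** * Regions and their bags, level by level *)

Section Decomposition.
Variables (G : sgraph) (hG : chordal G) (hcomb : ~ has_strict_comb G).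
Variable bag : set G -> set G.
Hypothesis bagP : forall C, is_piece C -> is_bag C (bag C).
Implicit Types (C : set G) (x y : G).

Inductive node : nat -> set G -> Prop :=
| node_root : node 0 setT
| node_child n C x : node n C -> C x -> ~ bag C x ->
    node n.+1 (component (C `\` bag C) x).

(** A boundary vertex of the child outside [bag C] would be outside [C] as well, hence in the
    boundary of [C] and so in [bag C]. *)
Lemma child_boundary C x : boundary C `<=` bag C ->
  boundary (component (C `\` bag C) x) `<=` bag C.
Proof.
move=> CK y yb; have nA := boundary_component yb.
have [_ [z [[Cz _] _] zy]] := yb; apply: contrapT => nKy; apply: nA.
split=> //; apply: contrapT => nCy; apply: nKy; apply: CK; split=> //.
by exists z.
Qed.

Lemma child_connected C x : C x -> ~ bag C x ->
  component (C `\` bag C) x !=set0 /\ connected_in (component (C `\` bag C) x).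
Proof.
by move=> Cx nKx; split; [exists x; apply: component_refl|apply: component_connected].
Qed.

Lemma node_is_piece n C : node n C -> is_piece C.
Proof.
elim=> [|{}n {}C x _ /bagP [[hK _] CK _ _] Cx nKx]; first by left.
have [C0 Ccon] := child_connected Cx nKx; right; split=> // y z yb zb.
by apply: hK; [exact: child_boundary CK _ yb|exact: child_boundary CK _ zb].
Qed.

Lemma node_bag n C : node n C -> is_bag C (bag C).
Proof. by move=> /node_is_piece /bagP. Qed.

Lemma node0 C : node 0 C -> C = setT.
Proof. by move=> nC; inversion nC. Qed.

Lemma nodeS n C : node n.+1 C ->
  exists C' x, [/\ node n C', C' x, ~ bag C' x & C = component (C' `\` bag C') x].
Proof. by move=> nC; inversion nC; subst; exists C0, x. Qed.

(** Parents of regions sharing [x] also share [x], so they agree by induction, and components of one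
    set that share [x] coincide. *)
Lemma node_unique n C C' x : node n C -> node n C' -> C x -> C' x -> C = C'.
Proof.
elim: n C C' => [|n IH] C C'; first by move=> /node0 -> /node0 ->.
move=> /nodeS [D [y [nD Dy nKy ->]]] /nodeS [D' [y' [nD' Dy' nKy' ->]]] cx cx'.
have e : D = D' by apply: IH => //; [case: cx => [[]]|case: cx' => [[]]].
by rewrite -{}e in cx' *; rewrite -(component_eq cx) -(component_eq cx').
Qed.

Lemma node_ancestor n m C x : node m C -> C x -> (n < m)%N ->
  exists C', [/\ node n C', C' x & ~ bag C' x].
Proof.
elim: m C => [//|m IH] C /nodeS [D [y [nD Dy nKy ->]]] [[Dx nKx] _].
rewrite ltnS leq_eqVlt => /orP [/eqP ->|nm]; first by exists D.
exact: IH nD Dx nm.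
Qed.

(** Once a bag takes [x] at level [n], the regions below no longer contain it. *)
Lemma node_bag_level n m C C' x : node n C -> node m C' -> C x -> C' x ->
  bag C x -> (m <= n)%N.
Proof.
move=> nC nC' Cx C'x Kx; rewrite leqNgt; apply/negP => nm.
have [D [nD Dx nKx]] := node_ancestor nC' C'x nm.
by apply: nKx; rewrite (node_unique nD nC Dx Cx).
Qed.

Lemma node_bag_unique n m C C' x : node n C -> node m C' -> C x -> C' x ->
  bag C x -> bag C' x -> n = m /\ C = C'.
Proof.
move=> nC nC' Cx C'x Kx K'x; have e : n = m.
  apply/eqP; rewrite eqn_leq; apply/andP; split.
    exact: node_bag_level nC' nC C'x Cx K'x.
  exact: node_bag_level nC nC' Cx C'x Kx.
by split=> //; rewrite -e in nC'; exact: (node_unique nC nC' Cx C'x).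
Qed.

(** A vertex never taken would survive in a region of every level, which [no_infinite_descent]
    excludes. *)
Lemma node_bag_cover x : exists n C, [/\ node n C, C x & bag C x].
Proof.
apply: contrapT => no.
have out n C : node n C -> C x -> ~ bag C x.
  by move=> nC Cx Kx; apply: no; exists n, C.
have /choice [D DP] n : exists C, node n C /\ C x.
  elim: n => [|n [C [nC Cx]]]; first by exists setT; split=> //; apply: node_root.
  exists (component (C `\` bag C) x).
  have nKx := out _ _ nC Cx.
  by split; [apply: node_child|apply: component_refl].
(* The regions were chosen independently; uniqueness at each level makes them a descending chain. *)
have DS n : D n.+1 = component (D n `\` bag (D n)) x.
  have [nD Dx] := DP n; have [nD' D'x] := DP n.+1; have nKx := out _ _ nD Dx.
  by apply: (node_unique nD' _ D'x); [apply: node_child|apply: component_refl].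
apply: (@no_infinite_descent G hG hcomb D (bag \o D) x) => n /=.
- by case: (DP n).
- by rewrite DS => y [].
- have [nD Dx] := DP n; rewrite DS; apply: (child_connected Dx _).2.
  exact: out nD Dx.
- have [nD Dx] := DP n; case: (node_bag nD) => _ _ _; apply; by exists x.
- by have [nD Dx] := DP n; case: (node_bag nD).
- by have [nD Dx] := DP n; case: (node_bag nD).
Qed.

(** Let [C] and [C'] be the regions that take [x] and [y]. If one endpoint is outside the other's
    region, it is in the boundary and so in that bag; otherwise both regions contain both vertices
    and coincide. *)
Lemma node_bag_edge x y : adj x y -> exists n C, [/\ node n C, bag C x & bag C y].
Proof.
move=> xy; have [n [C [nC Cx Kx]]] := node_bag_cover x.
have [m [C' [nC' C'y Ky]]] := node_bag_cover y.
have [_ CK _ _] := node_bag nC; have [_ C'K _ _] := node_bag nC'.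
have [Cy|nCy] := pselect (C y); last first.
  by exists n, C; split=> //; apply: CK; split=> //; exists x.
have [C'x|nC'x] := pselect (C' x); last first.
  by exists m, C'; split=> //; apply: C'K; split=> //; exists y => //; apply: adj_sym.
have e : n = m.
  apply/eqP; rewrite eqn_leq; apply/andP; split.
    exact: node_bag_level nC' nC C'y Cy Ky.
  exact: node_bag_level nC nC' Cx C'x Kx.
exists m, C'; rewrite e in nC; split=> //.
by rewrite -(node_unique nC nC' Cx C'x).
Qed.

(** * The tree of regions and its subtrees *)

Definition tnode := {p : nat * set G | node p.1 p.2}.

Definition level (t : tnode) : nat := (sval t).1.
Definition region (t : tnode) : set G := (sval t).2.

Definition parent (s t : tnode) :=
  level t = (level s).+1 /\ region t `<=` region s.

Lemma tnode_eq (s t : tnode) :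
  level s = level t -> region s = region t -> s = t.
Proof.
by case: s t => [[n C] nC] [[m D] nD]; rewrite /level /region /= => e1 e2;
  apply: eq_exist; rewrite e1 e2.
Qed.

(** The region of [t] is nonempty, and regions of one level that share a vertex are equal. *)
Lemma parent_unique s s' t : parent s t -> parent s' t -> s = s'.
Proof.
move=> [lt ts] [lt' ts']; have e : level s = level s' by lia.
apply: tnode_eq => //; have := svalP t; rewrite -/(level t) -/(region t) lt.
move=> /nodeS [C [x [_ Cx nKx rt]]].
have tx : region t x by rewrite rt; apply: component_refl.
have ns := svalP s; have := svalP s'; rewrite -/(level s') -e => ns'.
exact: node_unique ns ns' (ts _ tx) (ts' _ tx).
Qed.

Lemma parent_exists t : level t = 0 /\ region t = setT \/
  exists2 s, parent s t & boundary (region t) `<=` bag (region s).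
Proof.
case: t => -[[|n] C] /= nC; [left; split=> //; exact: node0|right].
have [D [x [nD Dx nKx e]]] := nodeS nC.
exists (exist _ (n, D) nD); rewrite /parent /region /=.
  by split=> //; rewrite e => y [[]].
by rewrite e; apply: child_boundary; case: (node_bag nD).
Qed.

Definition dtree : sgraph.
Proof.
refine (@SGraph tnode (fun s t => parent s t \/ parent t s) _ _).
- by move=> s t [?|?]; [right|left].
- by move=> s [[]|[]]; lia.
Defined.

Lemma dtree_adj_level (s t : dtree) : adj s t ->
  level t = (level s).+1 \/ level s = (level t).+1.
Proof. by move=> [[]|[]]; [left|right]. Qed.

Lemma dtree_parent_unique (s s' t : dtree) : adj s t -> adj s' t ->
  level t = (level s).+1 -> level t = (level s').+1 -> s = s'.
Proof.
move=> st s't l l'; apply: (@parent_unique s s' t).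
  by case: st => // -[]; lia.
by case: s't => // -[]; lia.
Qed.

Lemma dtree_is_tree : is_tree dtree.
Proof.
apply: (@graded_is_tree dtree level (exist _ (0, setT) node_root)).
- exact: dtree_adj_level.
- exact: dtree_parent_unique.
- move=> t; case: (parent_exists t) => [[l r]|[s st _]].
    by left; apply: tnode_eq.
  by right; exists s; [right|case: st].
Qed.

(** The root is the node that takes [x]. In any other node whose bag holds [x], the vertex lies in
    the boundary of the region, hence also in the parent bag. *)
Lemma dtree_subtree x : is_tree (induced [set t : dtree | bag (region t) x]).
Proof.
have [n [C [nC Cx Kx]]] := node_bag_cover x.
pose r : dtree := exist _ (n, C) nC.
have rP : r \in [set t : dtree | bag (region t) x] by apply/mem_set.
pose h (t : induced [set t : dtree | bag (region t) x]) := level (val t).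
apply: (@graded_is_tree _ h (exist _ r rP)).
- by move=> s t; apply: dtree_adj_level.
- move=> s s' t st s't l l'; apply: val_inj; exact: dtree_parent_unique st s't l l'.
- move=> [t tP]; have /= tx : bag (region t) x by move/set_mem: tP.
  have [rx|nrx] := pselect (region t x).
    left; apply: val_inj => /=.
    have [e1 e2] := node_bag_unique (svalP t) nC rx Cx tx Kx.
    exact: tnode_eq.
  have xb : boundary (region t) x by case: (node_bag (svalP t)) => _ _ /(_ x tx) [].
  right; case: (parent_exists t) => [[_ rT]|[s st sb]].
    by case: nrx; rewrite rT.
  have sP : (s : dtree) \in [set t : dtree | bag (region t) x].
    by apply/mem_set/sb.
  by exists (exist _ (s : dtree) sP) => /=; [right|case: st].
Qed.

End Decomposition.

(** * The tree-decomposition into maximal cliques *)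

Theorem theorem1p2 (G : sgraph) (hchordal : chordal G)
    (hcomb : ~ has_strict_comb G) :
  exists (T : sgraph) (V : T -> set G),
    is_tree_decomposition V /\ forall t : T, is_maximal_clique (V t).
Proof.
(* Bags are chosen for all sets at once, with [setT] as a dummy witness off the pieces. *)
have /choice [bag bagP] C : exists K : set G, is_piece C -> is_bag C K.
  have [/(piece_has_bag hchordal hcomb) [K hK]|no] := pselect (is_piece C).
    by exists K.
  by exists setT.
exists (dtree bag), (fun t => bag (region t)); split; last first.
  by move=> t; case: (node_bag bagP (svalP t)).
split; first exact: dtree_is_tree.
- move=> x; have [n [C [nC _ Kx]]] := node_bag_cover hchordal hcomb bagP x.
  by exists (exist _ (n, C) nC).
- move=> x y /(node_bag_edge hchordal hcomb bagP) [n [C [nC Kx Ky]]].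
  by exists (exist _ (n, C) nC).
- exact: dtree_subtree.
Qed.
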